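(* Suppose $\alpha<|a|_p=\beta$. Put $\acute\alpha(x)=|f(x)|_p$ for $x\in S_\alpha(0)\setminus\{\hat x_1\}$ and $\acute\beta(x)=|f(x)|_p$ for $x\in S_\beta(0)\setminus\{\hat x_2\}$. Then the $p$-adic dynamical system generated by $f$ has the following properties. 1. (1.1) $SI(x_1)=U_\alpha(0)$. (1.2) If $\alpha<r<\beta$, then $S_r(0)$ is invariant for $f$. 2. If $r>\beta$, then $f(S_r(0)\setminus\mathcal P)\subset S_\beta(0)$. 3. Let $x\in S_\alpha(0)\setminus\mathcal P$. (3.1) If $\acute\alpha(x)=\alpha$, then $f(x)\in S_\alpha(0)$. (3.2) If $\acute\alpha(x)\ne\alpha$ and $\acute\alpha(x)<\beta$, then $f^n(x)\in S_{\acute\alpha(x)}(0)$ for all $n\ge1$. (3.3) If $\acute\alpha(x)=\beta$, then $f(x)\in S_\beta(0)$. (3.4) If $\acute\alpha(x)>\beta$, then $f^2(x)\in S_\beta(0)$. 4. Let $x\in S_\beta(0)\setminus\mathcal P$. (4.1) If $\acute\beta(x)=\beta$, then $f(x)\in S_\beta(0)$. (4.2) If $\acute\beta(x)>\beta$, then $f^2(x)\in S_\beta(0)$. 5. $x_2\in V_\beta(0)$, and if $|a-d|_p\ne\alpha$, then $x_2$ is an indifferent fixed point of $f$. (5.1) If $|a-d|_p<\alpha$, then $SI(x_2)=SI(x_1)$. (5.2) If $|a-d|_p>\alpha$, then $SI(x_2)=U_{|x_2|_p}(x_2)$.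
   Context: $p$ is a prime and $\mathbb C_p$ is the field of complex $p$-adic numbers with norm $|\cdot|_p$. Let $a,b,d\in\mathbb C_p$ with $ab\neq0$, $a\ne d$, and $$f(x)=\frac{ax^2+bx}{x^2+dx+b},\qquad x\in\mathbb C_p\setminus\{\hat x_1,\hat x_2\},$$ where $\hat x_1,\hat x_2\in\mathbb C_p$ are the two (possibly equal) roots of $x^2+dx+b$. Put $\alpha=|\hat x_1|_p$, $\beta=|\hat x_2|_p$, labelled so that $\alpha\le\beta$. Standing assumption: $f$ has the two distinct fixed points $x_1=0$ and $x_2=a-d$ (in particular $x_2\notin\{\hat x_1,\hat x_2\}$, i.e. $b+a(a-d)\neq0$). $\mathcal P=\{x\in\mathbb C_p:\exists n\in\mathbb N\cup\{0\},\ f^n(x)\in\{\hat x_1,\hat x_2\}\}$, where $f^n$ is the $n$-th iterate ($f^0=\mathrm{id}$). For $c\in\mathbb C_p$, $r\geq 0$: $U_r(c)=\{x:|x-c|_p<r\}$, $V_r(c)=\{x:|x-c|_p\le r\}$, $S_r(c)=\{x:|x-c|_p=r\}$ (so $S_0(0)=\{0\}$). A fixed point $x_0$ is attractive, indifferent, repeller if $|f'(x_0)|_p<1$, $=1$, $>1$ respectively. A sphere $S$ is invariant if $f$ is defined on $S$ and $f(S)\subset S$. An open ball $U_r(x_0)$ about a fixed point $x_0$ is a Siegel disk if every sphere $S_\rho(x_0)$, $0<\rho<r$, is invariant; $SI(x_0)$ is the union of all Siegel disks centred at $x_0$ (the maximal Siegel disk). *)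

(* Defs.v *)
From HB Require Import structures.
From mathcomp Require Import all_boot all_order all_algebra.
From mathcomp Require Import boolp classical_sets reals.

Set Implicit Arguments.
Unset Strict Implicit.
Unset Printing Implicit Defensive.

Import Order.TTheory GRing.Theory Num.Theory.

Local Open Scope classical_set_scope.
Local Open Scope ring_scope.

Record nonarch_abs (R : realType) (K : fieldType) (v : K -> R) : Prop := {
  nabs_ge0 : forall x, 0 <= v x;
  nabs_eq0 : forall x, v x = 0 <-> x = 0;
  nabsM : forall x y, v (x * y) = v x * v y;
  nabsD : forall x y, v (x + y) <= Num.max (v x) (v y)
}.

Definition abs_complete (R : realType) (K : fieldType) (v : K -> R) : Prop :=
  forall u : nat -> K,
    (forall e : R, 0 < e -> exists N : nat, forall m n : nat,
       (N <= m)%N -> (N <= n)%N -> v (u m - u n) < e) ->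
    exists l : K, forall e : R, 0 < e -> exists N : nat, forall n : nat,
      (N <= n)%N -> v (u n - l) < e.

Definition abs_closure (R : realType) (K : fieldType) (v : K -> R)
    (A : set K) : set K :=
  [set x | forall e : R, 0 < e -> exists2 y, A y & v (x - y) < e].

(* When K is complete and v p = 1/p, the closure of the prime field is the
   completion of the rationals for the p-adic absolute value. *)
Definition Qp_in (R : realType) (K : fieldType) (v : K -> R) : set K :=
  abs_closure v (range (fun q : rat => ratr q : K)).

Definition algebraic_over_set (K : fieldType) (A : set K) : set K :=
  [set x | exists P : {poly K}, [/\ P != 0, forall i, A P`_i & root P x]].

(* (K, v) is C_p, the completion of an algebraic closure of Q_p with its
   absolute value normalised by |p| = 1/p. In the algebraically closed field K,
   the elements algebraic over Q_p form an algebraic closure of Q_p; K is its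
   completion when K is complete and these elements are dense. This determines
   (K, v) up to isometric isomorphism. *)
Record is_Cp (R : realType) (p : nat) (K : closedFieldType) (v : K -> R) :
    Prop := {
  Cp_abs : nonarch_abs v;
  Cp_norm_p : v p%:R = p%:R^-1;
  Cp_complete : abs_complete v;
  Cp_dense : abs_closure v (algebraic_over_set (Qp_in v)) = setT
}.

Definition Uball (R : realType) (K : fieldType) (v : K -> R) (r : R) (c : K) :
  set K := [set x | v (x - c) < r].

Definition Vball (R : realType) (K : fieldType) (v : K -> R) (r : R) (c : K) :
  set K := [set x | v (x - c) <= r].

Definition Sphere (R : realType) (K : fieldType) (v : K -> R) (r : R) (c : K) :
  set K := [set x | v (x - c) = r].

(* A partial map of K is given by a total function f : K -> K and its set Z of
   poles; the values of f on Z are irrelevant. *)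

(* If some iterate of x falls in Z, the iterates up to the first such one do not
   depend on the values of f on Z, so neither does the following set. *)
Definition pole_orbits (K : fieldType) (Z : set K) (f : K -> K) : set K :=
  [set x | exists n : nat, Z (iter n f x)].

Definition fixed_point (K : fieldType) (Z : set K) (f : K -> K) (x0 : K) :
  Prop := ~ Z x0 /\ f x0 = x0.

Definition has_deriv (R : realType) (K : fieldType) (v : K -> R) (f : K -> K)
    (x0 l : K) : Prop :=
  forall e : R, 0 < e -> exists2 delta : R, 0 < delta &
    forall x : K, 0 < v (x - x0) < delta ->
      v ((f x - f x0) / (x - x0) - l) < e.

Definition indifferent (R : realType) (K : fieldType) (v : K -> R) (Z : set K)
    (f : K -> K) (x0 : K) : Prop :=
  fixed_point Z f x0 /\ exists2 l : K, has_deriv v f x0 l & v l = 1.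

Definition invariant_set (K : fieldType) (Z : set K) (f : K -> K) (S : set K) :
  Prop := S `<=` ~` Z /\ f @` S `<=` S.

Definition Siegel_disk (R : realType) (K : fieldType) (v : K -> R) (Z : set K)
    (f : K -> K) (x0 : K) (r : R) : Prop :=
  [/\ 0 <= r, fixed_point Z f x0 &
      forall rho : R, 0 < rho < r -> invariant_set Z f (Sphere v rho x0)].

Definition SI (R : realType) (K : fieldType) (v : K -> R) (Z : set K)
    (f : K -> K) (x0 : K) : set K :=
  \bigcup_(r in [set r | Siegel_disk v Z f x0 r]) Uball v r x0.

Definition fmap (K : fieldType) (a b d x : K) : K :=
  (a * x ^+ 2 + b * x) / (x ^+ 2 + d * x + b).

(* Main.v *)
(* Write f(x) = x (a x + b) / ((x - xh1) (x - xh2)). Since |b| = alpha beta and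
   |a| = |d| = beta, the ultrametric inequality gives |f(x)| on every sphere
   about 0 except S_alpha(0) and S_beta(0). About x2 = a - d one has
   f(x) - x2 = (x - x2) (d x + b) / ((x - xh1) (x - xh2)), and with
   rho = max(alpha, |x2|) the last factor has norm 1 on U_rho(x2), whereas the
   pole xh1 lies on S_rho(x2); hence the maximal Siegel disk at x2 is U_rho(x2),
   which is U_alpha(0) when |x2| < alpha. *)
Require Import Defs.
From HB Require Import structures.
From mathcomp Require Import all_boot all_order all_algebra.
From mathcomp Require Import boolp classical_sets reals.
From mathcomp Require Import ring lra.

Import Order.TTheory GRing.Theory Num.Theory.

Local Open Scope classical_set_scope.
Local Open Scope ring_scope.

(** * Ultrametric absolute values, balls, and a criterion for maximal Siegel disks *)

Section NonarchAbs.
Variables (R : realType) (K : fieldType) (v : K -> R).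
Hypothesis hv : nonarch_abs v.

Lemma nabs0 : v 0 = 0.
Proof. exact/(nabs_eq0 hv). Qed.

Lemma nabs_gt0 x : x != 0 -> 0 < v x.
Proof.
move=> x0; rewrite lt_neqAle (nabs_ge0 hv) andbT eq_sym.
by apply/eqP => /(nabs_eq0 hv) xE; rewrite xE eqxx in x0.
Qed.

Lemma nabs_neq0 x : 0 < v x -> x != 0.
Proof. by move=> vx; apply/eqP => xE; rewrite xE nabs0 ltxx in vx. Qed.

Lemma nabs1 : v 1 = 1.
Proof.
have v1 := nabs_gt0 _ (oner_neq0 K).
by apply: (mulfI (lt0r_neq0 v1)); rewrite -(nabsM hv) !mulr1.
Qed.

Lemma nabsN x : v (- x) = v x.
Proof.
have vN1 : v (-1) = 1.
  have := nabs_ge0 hv (-1); have := nabsM hv (-1) (-1).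
  by rewrite mulrNN mulr1 nabs1 => e p; nra.
by rewrite -mulN1r (nabsM hv) vN1 mul1r.
Qed.

Lemma nabs_distC x y : v (x - y) = v (y - x).
Proof. by rewrite -nabsN opprB. Qed.

Lemma nabsV x : x != 0 -> v x^-1 = (v x)^-1.
Proof.
move=> x0; apply: (mulfI (lt0r_neq0 (nabs_gt0 _ x0))).
by rewrite -(nabsM hv) !divff ?nabs1 // (lt0r_neq0 (nabs_gt0 _ x0)).
Qed.

Lemma nabs_div x y : y != 0 -> v (x / y) = v x / v y.
Proof. by move=> y0; rewrite (nabsM hv) nabsV. Qed.

Lemma nabsD_le x y r : v x <= r -> v y <= r -> v (x + y) <= r.
Proof.
by move=> xr yr; apply: le_trans (nabsD hv x y) _; rewrite ge_max xr yr.
Qed.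

Lemma nabsD_lt x y r : v x < r -> v y < r -> v (x + y) < r.
Proof.
by move=> xr yr; apply: le_lt_trans (nabsD hv x y) _; rewrite gt_max xr yr.
Qed.

(** If [v (x + y)] were below [v x], then x = (x + y) - y would be a sum of two terms of norm below
    [v x]. *)
Lemma nabsDl x y : v y < v x -> v (x + y) = v x.
Proof.
move=> yx; apply/eqP; rewrite eq_le nabsD_le ?(ltW yx) //= leNgt.
apply/negP => xyx; have : v (x + y - y) < v x by apply: nabsD_lt; rewrite ?nabsN.
by rewrite addrK ltxx.
Qed.

Lemma nabsDr x y : v x < v y -> v (x + y) = v y.
Proof. by move=> xy; rewrite addrC nabsDl. Qed.

Lemma nabsBl x y : v y < v x -> v (x - y) = v x.
Proof. by move=> yx; rewrite nabsDl ?nabsN. Qed.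

Lemma nabsBr x y : v x < v y -> v (x - y) = v y.
Proof. by move=> xy; rewrite nabsDr nabsN. Qed.

Lemma nabs_dist_eq x y c : v (x - y) < v (y - c) -> v (x - c) = v (y - c).
Proof. by move=> xy; rewrite -(subrKA y) nabsDr. Qed.

Lemma Uball_eq r x y : v (x - y) < r -> Uball v r x = Uball v r y.
Proof.
move=> xy; apply/seteqP; split => z; rewrite /Uball /= => zr.
  by rewrite -(subrKA x); apply: nabsD_lt.
by rewrite -(subrKA y); apply: nabsD_lt; rewrite // nabs_distC.
Qed.

(** The pole [z] bounds every Siegel disk: a radius above [rho] would require the sphere through [z]
    to be invariant. Conversely, preservation of the distance to [x0] inside radius [rho] makes each
    smaller sphere invariant, so [rho] itself is attained. *)
Lemma SI_eq_Uball (Z : set K) (f : K -> K) x0 z rho :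
    fixed_point Z f x0 -> Z z -> v (z - x0) = rho -> 0 < rho ->
    (forall x, v (x - x0) < rho -> ~ Z x /\ v (f x - x0) = v (x - x0)) ->
  SI v Z f x0 = Uball v rho x0.
Proof.
move=> fx0 Zz zrho rho0 isom; apply/seteqP; split => x.
  case=> r [_ _ inv] /= xr; rewrite /Uball /=.
  apply: lt_le_trans xr _; rewrite leNgt; apply/negP => rho_r.
  have [sub _] : invariant_set Z f (Sphere v rho x0).
    by apply: inv; rewrite rho0 rho_r.
  exact: (sub z).
move=> xrho; exists rho => //; split => //; first exact: ltW.
move=> s /andP[_ s_rho]; split => [y|_ [y + <-]]; rewrite /Sphere /= => ys.
  by apply: (isom y _).1; rewrite ys.
by rewrite (isom y _).2 ys.
Qed.

End NonarchAbs.

(** * Norm of f on the spheres about 0 *)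

Section QuadraticMap.
Variables (R : realType) (K : fieldType) (v : K -> R).
Hypothesis hv : nonarch_abs v.
Variables a b d xh1 xh2 : K.
Hypotheses (dE : d = - (xh1 + xh2)) (bE : b = xh1 * xh2).
Hypotheses (xh1_gt0 : 0 < v xh1) (xh12 : v xh1 < v xh2) (va : v a = v xh2).

Let f := fmap a b d.
Let Z : set K := [set xh1; xh2].

Let xh2_gt0 : 0 < v xh2.
Proof. exact: lt_trans xh12. Qed.

Let vb : v b = v xh1 * v xh2.
Proof. by rewrite bE (nabsM hv). Qed.

Let vd : v d = v xh2.
Proof. by rewrite dE nabsN // nabsDr. Qed.

Lemma fmap_factor x : f x = x * (a * x + b) / ((x - xh1) * (x - xh2)).
Proof. by rewrite /f /fmap dE bE; congr (_ / _); ring. Qed.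

Lemma nonpole_dist x r1 r2 :
  v (x - xh1) = r1 -> v (x - xh2) = r2 -> 0 < r1 -> 0 < r2 -> ~ Z x.
Proof.
by move=> e1 e2 r1_0 r2_0 [] /= xE; subst x;
  [rewrite -e1 in r1_0 | rewrite -e2 in r2_0];
  rewrite subrr nabs0 // ltxx in r1_0 r2_0 *.
Qed.

Lemma nabs_fmap x : ~ Z x ->
  v (f x) = v x * v (a * x + b) / (v (x - xh1) * v (x - xh2)).
Proof.
move=> Zx; rewrite fmap_factor nabs_div ?(nabsM hv) //.
by rewrite mulf_neq0 // subr_eq0; apply/eqP => xE; apply: Zx; [left|right].
Qed.

(** Here b dominates a x, and the two factors of the denominator have norms alpha and beta, so the
    quotient is |x| (alpha beta) / (alpha beta). *)
Lemma fmap_inner x : v x < v xh1 -> ~ Z x /\ v (f x) = v x.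
Proof.
move=> x1; have x2 := lt_trans x1 xh12.
have e1 : v (x - xh1) = v xh1 by rewrite nabsBr.
have e2 : v (x - xh2) = v xh2 by rewrite nabsBr.
have Zx := nonpole_dist _ _ _ e1 e2 xh1_gt0 xh2_gt0.
split=> //; rewrite nabs_fmap // e1 e2 nabsDr //.
  by rewrite vb mulfK // mulf_neq0 // lt0r_neq0.
by rewrite vb (nabsM hv) va mulrC ltr_pM2r.
Qed.

(** Now a x dominates b and x dominates [xh1]: the quotient is |x| (beta |x|) / (|x| beta). *)
Lemma fmap_middle x : v xh1 < v x < v xh2 -> ~ Z x /\ v (f x) = v x.
Proof.
move=> /andP[x1 x2]; have x0 := lt_trans xh1_gt0 x1.
have e1 : v (x - xh1) = v x by rewrite nabsBl.
have e2 : v (x - xh2) = v xh2 by rewrite nabsBr.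
have Zx := nonpole_dist _ _ _ e1 e2 x0 xh2_gt0.
split=> //; rewrite nabs_fmap // e1 e2 nabsDl // (nabsM hv) va.
  by rewrite [v xh2 * _]mulrC mulfK // mulf_neq0 // lt0r_neq0.
by rewrite vb mulrC ltr_pM2l.
Qed.

(** Here x dominates both poles: the quotient is |x| (beta |x|) / |x|^2. *)
Lemma fmap_outer x : v xh2 < v x -> v (f x) = v xh2.
Proof.
move=> x2; have x1 := lt_trans xh12 x2; have x0 := lt_trans xh2_gt0 x2.
have e1 : v (x - xh1) = v x by rewrite nabsBl.
have e2 : v (x - xh2) = v x by rewrite nabsBl.
have Zx := nonpole_dist _ _ _ e1 e2 x0 x0.
rewrite nabs_fmap // e1 e2 nabsDl // (nabsM hv) va.
  by rewrite mulrCA mulfK // mulf_neq0 // lt0r_neq0.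
by rewrite vb mulrC ltr_pM2l.
Qed.

Lemma fixed_point0 : fixed_point Z f 0.
Proof.
split; first by have [] := fmap_inner 0; rewrite ?nabs0.
by rewrite fmap_factor !mul0r.
Qed.

Lemma SI0 : SI v Z f 0 = Uball v (v xh1) 0.
Proof.
apply: (@SI_eq_Uball _ _ _ _ _ _ xh1) => //.
- exact: fixed_point0.
- by left.
- by rewrite subr0.
- by move=> x; rewrite !subr0; apply: fmap_inner.
Qed.

Lemma iter_sphere r : r < v xh2 -> r <> v xh1 ->
  forall n x, v x = r -> v (iter n f x) = r.
Proof.
move=> r2 r1 n x xr; elim: n => //= n IH.
case: (ltgtP r (v xh1)) => // r1'.
  by have [] := fmap_inner (iter n f x); rewrite IH.
by have [] := fmap_middle (iter n f x); rewrite IH // r1' r2.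
Qed.

(** * The fixed point x2 = a - d: its Siegel disk and its multiplier *)

Section SecondFixedPoint.
Hypothesis x2_neq : v (a - d) <> v xh1.

Let rho := Num.max (v xh1) (v (a - d)).

Let rho_gt0 : 0 < rho.
Proof. by rewrite lt_max xh1_gt0. Qed.

Lemma second_fixed_point_le : v (a - d) <= v xh2.
Proof. by apply: nabsD_le; rewrite ?nabsN // ?va ?vd. Qed.

(** The terms have norms beta |x2| and beta alpha, which differ, so the larger one wins. The case c
    = a serves the distance from x2 to [xh2], the case c = d the numerator of the factor in f(x) -
    x2. *)
Lemma nabs_linear_second c : v c = v xh2 -> v (c * (a - d) + b) = rho * v xh2.
Proof.
move=> vc; rewrite /rho; have [x2|x2|x2] := ltgtP (v xh1); last by case: x2_neq.
  by rewrite [LHS]nabsDl // (nabsM hv) vc 1?mulrC // vb ltr_pM2r.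
by rewrite [LHS]nabsDr // vb // (nabsM hv) vc mulrC ltr_pM2r.
Qed.

Lemma nabs_dist_xh1 : v (a - d - xh1) = rho.
Proof.
rewrite /rho; have [x2|x2|x2] := ltgtP (v xh1); last by case: x2_neq.
  by rewrite nabsBl.
by rewrite nabsBr.
Qed.

(* (x2 - xh1) (x2 - xh2) = a x2 + b, because x2 + d = a. *)
Lemma nabs_dist_xh2 : v (a - d - xh2) = v xh2.
Proof.
apply: (mulfI (lt0r_neq0 rho_gt0)).
rewrite -[in LHS]nabs_dist_xh1 -(nabsM hv) -(nabs_linear_second a) //.
by congr v; rewrite dE bE; ring.
Qed.

Lemma rho_le : rho <= v xh2.
Proof. by rewrite /rho ge_max ltW // second_fixed_point_le. Qed.

Section Ball.
Variable x : K.
Hypothesis xrho : v (x - (a - d)) < rho.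

Let e1 : v (x - xh1) = rho.
Proof. by rewrite (@nabs_dist_eq _ _ _ hv _ (a - d)) nabs_dist_xh1. Qed.

Let e2 : v (x - xh2) = v xh2.
Proof.
by rewrite (@nabs_dist_eq _ _ _ hv _ (a - d)) nabs_dist_xh2 ?(lt_le_trans xrho rho_le).
Qed.

Let eN : v (d * x + b) = rho * v xh2.
Proof.
(* Perturbation from x2: the added term has norm below rho beta, the norm of the value at x2. *)
have -> : d * x + b = d * (a - d) + b + d * (x - (a - d)) by ring.
rewrite nabsDl // nabs_linear_second // (nabsM hv) vd mulrC.
by rewrite ltr_pM2r.
Qed.

Lemma near_second_nonpole : ~ Z x.
Proof. exact: nonpole_dist e1 e2 rho_gt0 xh2_gt0. Qed.

Lemma near_second_denom : v (x ^+ 2 + d * x + b) = rho * v xh2.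
Proof. by rewrite -[in RHS]e1 -e2 -(nabsM hv); congr v; rewrite dE bE; ring. Qed.

Lemma near_second_denom_neq0 : x ^+ 2 + d * x + b != 0.
Proof. by apply: (nabs_neq0 _ _ _ hv); rewrite near_second_denom mulr_gt0. Qed.

Lemma fmap_sub_second :
  f x - (a - d) = (x - (a - d)) * ((d * x + b) / (x ^+ 2 + d * x + b)).
Proof. by rewrite /f /fmap; field; exact: near_second_denom_neq0. Qed.

Lemma nabs_fmap_sub_second : v (f x - (a - d)) = v (x - (a - d)).
Proof.
rewrite fmap_sub_second (nabsM hv) nabs_div ?near_second_denom_neq0 //.
by rewrite eN near_second_denom divff ?mulr1 // mulf_neq0 // lt0r_neq0.
Qed.

Lemma near_second_le : v x <= rho.
Proof.
rewrite -(subrK (a - d) x); apply: nabsD_le => //; first exact: ltW.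
by rewrite /rho le_max lexx orbT.
Qed.

End Ball.

Let near_self : v (a - d - (a - d)) < rho.
Proof. by rewrite subrr nabs0. Qed.

Lemma fixed_point_second : fixed_point Z f (a - d).
Proof.
split; first exact: near_second_nonpole near_self.
by apply/eqP; rewrite -subr_eq0 fmap_sub_second // subrr mul0r.
Qed.

Lemma SI_second : SI v Z f (a - d) = Uball v rho (a - d).
Proof.
apply: (@SI_eq_Uball _ _ _ _ _ _ xh1) => //.
- exact: fixed_point_second.
- by left.
- by rewrite nabs_distC // nabs_dist_xh1.
- by move=> x xr; split; [exact: near_second_nonpole|exact: nabs_fmap_sub_second].
Qed.

(** By [fmap_sub_second] the difference quotient at x2 is (d x + b) / (x^2 + d x + b); its value at
    x2 is the derivative, of norm (rho beta) / (rho beta) = 1. *)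
Lemma indifferent_second : indifferent v Z f (a - d).
Proof.
have x2f := fixed_point_second; split=> //.
set x2 := a - d in x2f *.
have D2 := near_second_denom_neq0 _ near_self.
exists ((d * x2 + b) / (x2 ^+ 2 + d * x2 + b)); last first.
  rewrite nabs_div // near_second_denom // nabs_linear_second //.
  by rewrite divff // mulf_neq0 // lt0r_neq0.
(* The bound [rho] keeps x inside the ball where the denominator has norm rho beta. There the
   quotient differs from its value at x2 by at most |x - x2| / beta, whence e beta. *)
move=> e e0; exists (Num.min rho (e * v xh2)).
  by rewrite lt_min rho_gt0 mulr_gt0.
move=> x /andP[xx2]; rewrite lt_min => /andP[xrho xe].
have D := near_second_denom_neq0 _ xrho.
have xx2_0 := nabs_neq0 _ _ _ hv _ xx2.
rewrite x2f.2 fmap_sub_second // mulrAC mulfV // mul1r.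
have -> : (d * x + b) / (x ^+ 2 + d * x + b) -
    (d * x2 + b) / (x2 ^+ 2 + d * x2 + b) =
    - ((x - x2) * (d * x * x2 + b * (x + x2))) /
    ((x ^+ 2 + d * x + b) * (x2 ^+ 2 + d * x2 + b)).
  by field; rewrite D D2.
rewrite nabs_div ?mulf_neq0 // nabsN // !(nabsM hv _ (_ + b)) (nabsM hv (x - x2)).
rewrite !near_second_denom // ltr_pdivrMr ?mulr_gt0 //.
have xr := near_second_le _ xrho; have x2r := near_second_le _ near_self.
have x1r : v xh1 <= rho by rewrite /rho le_max lexx.
(* Since |x|, |x2| and alpha are at most rho, both d x x2 and b (x + x2) have norm at most rho^2
   beta. *)
apply: (@le_lt_trans _ _ (v (x - x2) * (rho * rho * v xh2))).
  rewrite ler_wpM2l ?(nabs_ge0 hv) //; apply: nabsD_le => //.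
    rewrite !(nabsM hv) vd -mulrA mulrC ler_wpM2r ?(nabs_ge0 hv) //.
    by rewrite ler_pM ?(nabs_ge0 hv).
  rewrite (nabsM hv) vb mulrAC ler_wpM2r ?(nabs_ge0 hv) //.
  by rewrite ler_pM ?(nabs_ge0 hv) // nabsD_le.
have -> : e * (rho * v xh2 * (rho * v xh2)) =
  e * v xh2 * (rho * rho * v xh2) by ring.
by rewrite ltr_pM2r // !mulr_gt0.
Qed.

End SecondFixedPoint.
End QuadraticMap.

(** * Assembly of the statements over C_p *)

Theorem theorem8 (R : realType) (p : nat) (p_prime : prime p)
    (Cp : closedFieldType) (v : Cp -> R) (hCp : is_Cp p v)
    (a b d xh1 xh2 : Cp) (alpha beta : R)
    (hab : a * b != 0) (had : a != d)
    (hroots : 'X^2 + d *: 'X + b%:P = ('X - xh1%:P) * ('X - xh2%:P))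
    (halpha : alpha = v xh1) (hbeta : beta = v xh2) (hle : alpha <= beta)
    (hx2 : b + a * (a - d) != 0)
    (h1 : alpha < v a) (h2 : v a = beta) :
  let f : Cp -> Cp := fmap a b d in
  let Z : set Cp := [set xh1; xh2] in
  let P : set Cp := pole_orbits Z f in
  let x1 : Cp := 0 in
  let x2 : Cp := a - d in
  [/\ (SI v Z f x1 = Uball v alpha 0) /\
      (forall r : R, alpha < r < beta -> invariant_set Z f (Sphere v r 0)),
      (forall r : R, beta < r -> f @` (Sphere v r 0 `\` P) `<=` Sphere v beta 0),
      (forall x : Cp, (Sphere v alpha 0 `\` P) x ->
        let alpha' := v (f x) in
        [/\ alpha' = alpha -> Sphere v alpha 0 (f x),
            alpha' <> alpha -> alpha' < beta ->
              forall n : nat, (1 <= n)%N -> Sphere v alpha' 0 (iter n f x),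
            alpha' = beta -> Sphere v beta 0 (f x)
          & alpha' > beta -> Sphere v beta 0 (iter 2 f x)]),
      (forall x : Cp, (Sphere v beta 0 `\` P) x ->
        let beta' := v (f x) in
        (beta' = beta -> Sphere v beta 0 (f x)) /\
        (beta' > beta -> Sphere v beta 0 (iter 2 f x)))
    & [/\ Vball v beta 0 x2,
          v (a - d) <> alpha -> indifferent v Z f x2,
          v (a - d) < alpha -> SI v Z f x2 = SI v Z f x1
        & v (a - d) > alpha -> SI v Z f x2 = Uball v (v x2) x2]].
Proof.
move=> f Z P x1 x2.
have hv := Cp_abs hCp.
have fact x : x ^+ 2 + d * x + b = (x - xh1) * (x - xh2).
  by move/(congr1 (horner^~ x)): hroots; rewrite !hornerE.
have bE : b = xh1 * xh2.
  by have := fact 0; rewrite expr0n mulr0 !add0r mulrNN.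
have dE : d = - (xh1 + xh2).
  have -> : d = 1 ^+ 2 + d * 1 + b - 1 - b by ring.
  by rewrite fact bE; ring.
have xh1_gt0 : 0 < v xh1.
  apply: nabs_gt0 => //; apply: contra_neq hab => xh1_0.
  by rewrite bE xh1_0 mul0r mulr0.
have xh12 : v xh1 < v xh2 by rewrite -halpha -hbeta -h2.
have va : v a = v xh2 by rewrite h2.
have outer x : beta < v x -> v (f x) = beta.
  rewrite hbeta; exact: (@fmap_outer _ _ _ hv _ _ _ xh1).
have SI1 : SI v Z f x1 = Uball v alpha 0 by rewrite halpha; apply: SI0.
split.
- split=> // r r12; split => [x|_ [x + <-]]; rewrite /Sphere /= subr0 => xr;
    by have [] := @fmap_middle _ _ _ hv a b d xh1 xh2 dE bE xh1_gt0 xh12 va x;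
    rewrite ?subr0 xr -?halpha -?hbeta.
- by move=> r r2 _ [x [+ _] <-]; rewrite /Sphere /= !subr0 => xr;
    apply: outer; rewrite xr.
- move=> x [xa xP] alpha'; split; rewrite /Sphere /= ?subr0 //.
  (* The first step moves x to the sphere of radius [alpha']; the remaining n steps start at f x and
     stay on it. *)
  + move=> n1 n2 [//|n] _; rewrite subr0 iterSr.
    by apply: (@iter_sphere _ _ _ hv a b d xh1 xh2) => //; rewrite -?halpha -?hbeta.
  + exact: outer.
- by move=> x [xa xP] beta'; split; rewrite /Sphere /= ?subr0 //; apply: outer.
have SI2 : v x2 <> v xh1 -> SI v Z f x2 = Uball v (Num.max (v xh1) (v x2)) x2.
  by move=> ?; apply: SI_second.
split.
- by rewrite /Vball /= subr0 hbeta; apply: second_fixed_point_le dE xh12 va.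
- by rewrite halpha => ?; apply: indifferent_second.
(* The maximum is alpha, and 0 lies in the ball of radius alpha about x2, so that ball may be
   recentred at 0. *)
- move=> x2a; rewrite SI1 SI2 -halpha; last by apply/eqP; rewrite lt_eqF.
  by rewrite max_l ?ltW //; apply: Uball_eq; rewrite // subr0.
- move=> x2a; rewrite SI2 -halpha; last by apply/eqP; rewrite gt_eqF.
  by rewrite max_r ?ltW.
Qed.
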